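(* Any finite ordered family $I_1,\dots,I_n$ of intervals on the real line can be quasi-online $3$-properly $2$-colored; that is, there is a coloring of $I_1,\dots,I_n$ with the colors red and blue such that for every $t\in\{1,\dots,n\}$ and every point $p\in\mathbb{R}$ contained in at least $3$ of the intervals $I_1,\dots,I_t$, at least one of the intervals among $I_1,\dots,I_t$ containing $p$ is red and at least one of them is blue.
   Context: An interval is a set $\{x\in\mathbb{R} : x_0<x<x_1\}$ for fixed $x_0,x_1$. Quasi-online means that the whole ordered family is known before coloring, but the coloring has to be proper for every initial segment $I_1,\dots,I_t$ of the family. *)

(* Defs.v *)
From mathcomp Require Import all_boot all_order all_algebra.
From mathcomp Require Import reals.

Set Implicit Arguments.
Unset Strict Implicit.
Unset Printing Implicit Defensive.

Import Order.TTheory GRing.Theory Num.Theory.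
Local Open Scope ring_scope.

(* No relation between x0 and x1 is required: the interval may be empty. *)
Definition open_interval (R : realType) (J : interval R) : Prop :=
  exists x0 x1 : R, J = `]x0, x1[.

Inductive color := red | blue.

(* The interval I_k of the 1-based ordered family I_1, ..., I_n is I i for
   the ordinal i of value k - 1, so I_1, ..., I_t are the I i with i < t. *)
Definition containing (R : realType) (n : nat) (I : 'I_n -> interval R)
    (t : nat) (p : R) : {set 'I_n} :=
  [set i : 'I_n | (i < t)%N && (p \in I i)].

Definition quasi_online_proper (m : nat) (R : realType) (n : nat)
    (I : 'I_n -> interval R) (c : 'I_n -> color) : Prop :=
  forall (t : nat) (p : R), (1 <= t <= n)%N ->
    (m <= #|containing I t p|)%N ->
    (exists2 i, i \in containing I t p & c i = red) /\
    (exists2 i, i \in containing I t p & c i = blue).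

(* Main.v *)
Require Import Defs.
From mathcomp Require Import all_boot all_order all_algebra.
From mathcomp Require Import boolp reals.

(** Why three covering intervals suffice.

    Keep a set P of points whose constraints are still to be met, initially
    the whole line, and let t be the least length of a prefix I_1, ..., I_t
    that covers some point q of P three times.  By minimality of t, a prefix
    covering a point of P three times has length at least t, hence contains
    all of I_1, ..., I_t.  So once two of these intervals get different
    colors, every point of P lying in both may be removed from P.

    Take three intervals of the prefix through q, with left endpoints in the
    order x, y, z.
    - If one of them, u, is included in another one, v, give u the color
      opposite to v.  All points of P in u also lie in v, so they are settled;
      after their removal u covers no point of P and is deleted ([drop_nested]).
    - Otherwise the right endpoints are in the order x, y, z as well.  Since
      the intervals share q, y is included in the union of x and z, and the
      intersection of x and z is included in y.  Give x and z the same color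
      and y the opposite one.  This settles the points of P in y, which lie
      also in x or in z, and y is deleted.  Each remaining point lies in at
      most one of x and z, and their union is an interval, so x and z are
      replaced by this union without changing how many intervals cover a
      remaining point ([merge_outer]).
    In both cases the family gets smaller, and induction on its size
    concludes ([prefix_colorableT]).  If no point of P is ever covered three
    times, every coloring will do. *)

Set Implicit Arguments.
Unset Strict Implicit.
Unset Printing Implicit Defensive.

Import Order.TTheory.
Local Open Scope order_scope.

Definition bichromatic (I : finType) (c : I -> bool) (S : {set I}) : Prop :=
  forall b, exists2 i, i \in S & c i = b.

Lemma bichromatic_neq (I : finType) (c : I -> bool) (S : {set I}) (i j : I) :
  i \in S -> j \in S -> c i = ~~ c j -> bichromatic c S.
Proof.
move=> iS jS cij b; case: (eqVneq (c j) b) => [<-|]; first by exists j.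
by move=> cjb; exists i => //; rewrite cij; case: (c j) b cjb => [] [].
Qed.

Section Reductions.

Context {d : Order.disp_t} {T : orderType d} {n : nat}.
Implicit Types (P : pred T) (A : {set 'I_n}) (lo hi : 'I_n -> T).
Implicit Types (i j x y z u v : 'I_n) (s t : nat) (p q : T).

Definition stabbed A lo hi t p : {set 'I_n} :=
  [set i in A | (i < t)%N && (lo i < p < hi i)].

(** Intervals are deleted by shrinking the index set A, so that those that
    remain keep their times of arrival, and points are deleted through P. *)
Definition prefix_coloring P A lo hi (c : 'I_n -> bool) : Prop :=
  forall t p, P p -> (3 <= #|stabbed A lo hi t p|)%N ->
    bichromatic c (stabbed A lo hi t p).

Definition prefix_colorable P A lo hi : Prop :=
  exists c, prefix_coloring P A lo hi c.

(** This is what minimality of the prefix I_1, ..., I_t gives for each of its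
    members; it is all that the two reductions use about the prefix. *)
Definition early P A lo hi i : Prop :=
  forall t p, P p -> (3 <= #|stabbed A lo hi t p|)%N -> (i < t)%N.

Definition avoiding P lo hi y : pred T :=
  [pred p | P p && ~~ (lo y < p < hi y)].

(** Every point of u also lies in v, and both intervals are present as soon as
    three intervals cover the point; opposite colors settle it. *)
Lemma drop_nested P A lo hi u v :
  u != v -> u \in A -> v \in A ->
  early P A lo hi u -> early P A lo hi v -> lo v <= lo u -> hi u <= hi v ->
  prefix_colorable (avoiding P lo hi u) (A :\ u) lo hi ->
  prefix_colorable P A lo hi.
Proof.
move=> uv uA vA eu ev lovu hiuv [c cP].
exists (fun i => if i == u then ~~ c v else c i) => t p Pp ge3.
have [/andP[lup puh]|pNu] := boolP (lo u < p < hi u).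
  apply: (@bichromatic_neq _ _ _ u v).
  - by rewrite !inE uA (eu _ _ Pp ge3) lup puh.
  - by rewrite !inE vA (ev _ _ Pp ge3) (le_lt_trans lovu) // (lt_le_trans puh).
  - by rewrite eqxx eq_sym (negPf uv).
have eqS : stabbed (A :\ u) lo hi t p = stabbed A lo hi t p.
  apply/setP => i; rewrite !inE; case: eqP => //= ->.
  by rewrite (negPf pNu) !andbF.
move=> b; have [||i] := cP t p _ _ b; first by rewrite /avoiding /= Pp.
  by rewrite eqS.
rewrite eqS => iS <-; exists i => //; case: eqP => // iu.
by move: iS; rewrite iu !inE (negPf pNu) !andbF.
Qed.

(** The interval x is enlarged to the union of x and z, which is an interval
    because of the common point q.  The union arrives at the time of x, maybe
    not that of z, but this is invisible: x and z are both early, so they have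
    both arrived whenever the constraint of a point of P is active. *)
Lemma merge_outer P A lo hi x y z q :
  x != y -> y != z -> x != z -> x \in A -> y \in A -> z \in A ->
  early P A lo hi x -> early P A lo hi y -> early P A lo hi z ->
  lo x <= lo y <= lo z -> hi x <= hi y <= hi z -> lo z < q < hi x ->
  prefix_colorable (avoiding P lo hi y) (A :\ y :\ z) lo
    (fun i => if i == x then hi z else hi i) ->
  prefix_colorable P A lo hi.
Proof.
move=> xy yz xz xA yA zA ex ey ez /andP[lxy lyz] /andP[hxy hyz].
move=> /andP[lzq qhx]; set hi' := fun i => _; move=> [c cP].
have inU p : (lo x < p < hi z) = (lo x < p < hi x) || (lo z < p < hi z).
  apply/idP/orP => [/andP[lp ph]|[]/andP[lp ph]].
  - case: (ltP p (hi x)) => phx; first by left; rewrite lp.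
    by right; rewrite ph (lt_le_trans lzq) // (le_trans (ltW qhx)).
  - by rewrite lp (lt_le_trans ph) // (le_trans hxy).
  - by rewrite ph (le_lt_trans _ lp) // (le_trans lxy).
pose c' i := if i == y then ~~ c x else if i == z then c x else c i.
exists c' => t p Pp ge3.
have [xt yt zt] := And3 (ex _ _ Pp ge3) (ey _ _ Pp ge3) (ez _ _ Pp ge3).
have c'x : c' x = c x by rewrite /c' (negPf xy) (negPf xz).
have c'z : c' z = c x by rewrite /c' eq_sym (negPf yz) eqxx.
have c'y : c' y = ~~ c x by rewrite /c' eqxx.
have [/andP[lyp pyh]|pNy] := boolP (lo y < p < hi y).
  have yS : y \in stabbed A lo hi t p by rewrite !inE yA yt lyp.
  have : (lo x < p < hi x) || (lo z < p < hi z).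
    by rewrite -inU (le_lt_trans lxy) // (lt_le_trans pyh).
  case/orP => pin.
    by apply: (bichromatic_neq yS (j := x)); rewrite ?c'x // !inE xA xt.
  by apply: (bichromatic_neq yS (j := z)); rewrite ?c'z // !inE zA zt.
set S := stabbed A lo hi t p in ge3 *.
set S' := stabbed (A :\ y :\ z) lo hi' t p.
have xzS : ~ (x \in S /\ z \in S).
  rewrite !inE => -[/and3P[_ _ /andP[_ phx]] /and3P[_ _ /andP[lzp _]]].
  by case/negP: pNy; rewrite (le_lt_trans lyz lzp) (lt_le_trans phx hxy).
have yS : y \notin S by rewrite !inE (negPf pNy) !andbF.
have xS' : (x \in S') = (x \in S) || (z \in S).
  by rewrite !inE xz xy xA zA xt zt /hi' eqxx inU.
have oS' i : i != x -> i != z -> (i \in S') = (i \in S).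
  move=> ix iz; have [->|iy] := eqVneq i y.
    by rewrite (negPf yS) !inE eqxx !andbF.
  by rewrite !inE iy iz /hi' (negPf ix).
(* A point outside y is not in both x and z, so redirecting z to the union
   loses no covering interval. *)
pose f i := if i == z then x else i.
have fS : f @: S \subset S'.
  apply/subsetP => _ /imsetP[i iS ->]; rewrite /f.
  case: eqP => [iz|/eqP iz]; first by rewrite xS' -iz iS orbT.
  have [ix|ix] := eqVneq i x; last by rewrite oS'.
  by rewrite ix xS' -ix iS.
have f_inj : {in S &, injective f}.
  move=> i j iS jS; rewrite /f.
  case: eqP => [iz|_]; case: eqP => [jz|_] //; first by rewrite iz jz.
    by move=> xj; case: xzS; rewrite xj -iz.
  by move=> ix; case: xzS; rewrite -ix -jz.
have ge3' : (3 <= #|S'|)%N.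
  by rewrite (leq_trans ge3) // -(card_in_imset f_inj) subset_leq_card.
move=> b; have [|i iS' <-] := cP t p _ ge3' b; first by rewrite /avoiding /= Pp.
have [ix|ix] := eqVneq i x.
  by move: iS'; rewrite ix xS' => /orP[xS|zS]; [exists x|exists z].
have iz : i != z by move: iS'; rewrite !inE => /andP[/andP[]].
have iS : i \in S by rewrite -oS'.
exists i => //; rewrite /c' (negPf iz).
by have [iy|//] := eqVneq i y; rewrite -iy iS in yS.
Qed.

Lemma sorted_triple lo (S : {set 'I_n}) : (3 <= #|S|)%N ->
  exists x y z, [/\ x \in S, y \in S & z \in S] /\
    [/\ x != y, y != z, x != z & lo x <= lo y <= lo z].
Proof.
move=> ge3; pose le i j := lo i <= lo j.
have le_tot : total le by move=> i j; apply: le_total.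
have le_tr : transitive le by move=> j i k; apply: le_trans.
have := sort_sorted le_tot (enum S).
have : size (sort le (enum S)) = #|S| by rewrite size_sort cardE.
have : uniq (sort le (enum S)) by rewrite sort_uniq enum_uniq.
have memS i : i \in sort le (enum S) -> i \in S by rewrite mem_sort mem_enum.
case: (sort le (enum S)) memS => [|x [|y [|z r]]] memS;
  try by move=> _ sizeS; rewrite -sizeS in ge3.
move=> /= /and3P[xN yN _] _ /and3P[xy yz _].
move: xN yN; rewrite !inE !negb_or => /and3P[xNy xNz _] /andP[yNz _].
exists x, y, z; do 2 split=> //; rewrite ?memS ?inE ?eqxx ?orbT //.
exact/andP.
Qed.

(** The point set P and the right endpoints vary in the induction: each step
    deletes points, and a merge moves a right endpoint. *)
Lemma prefix_colorableT P A lo hi : prefix_colorable P A lo hi.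
Proof.
have [m] := ubnP #|A|; elim: m => // m IH in P A hi *; rewrite ltnS => Am.
pose busy t := `[< exists2 p, P p & (3 <= #|stabbed A lo hi t p|)%N >].
have [exb|nob] := pselect (exists t, busy t); last first.
  exists xpredT => t p Pp ge3; case: nob; exists t; apply/asboolP.
  by exists p.
case: (ex_minnP exb) => t /asboolP[q Pq ge3] tmin.
have earlyS i : i \in stabbed A lo hi t q -> early P A lo hi i.
  rewrite inE => /and3P[_ it _] t' p Pp ge3'; apply: leq_trans it (tmin _ _).
  by apply/asboolP; exists p.
have [x [y [z [[xS yS zS] [xy yz xz lsorted]]]]] := sorted_triple lo ge3.
have [ex ey ez] := And3 (earlyS _ xS) (earlyS _ yS) (earlyS _ zS).
move: xS yS zS; rewrite !inE => /and3P[xA _ xq] /and3P[yA _ yq] /and3P[zA _ zq].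
have [/andP[_ qx] /andP[qz _]] := (xq, zq).
have smaller (B : {set 'I_n}) i : i \in A -> B \subset A :\ i -> (#|B| < m)%N.
  move=> iA /subset_leq_card leB; apply: leq_trans Am.
  by rewrite (cardsD1 i A) iA.
case: (leP (hi y) (hi x)) => [hyx|/ltW hxy].
  apply: (@drop_nested _ _ _ _ y x) => //; first by rewrite eq_sym.
    by case/andP: lsorted.
  exact/IH/(smaller _ y).
case: (leP (hi z) (hi y)) => [hzy|/ltW hyz].
  apply: (@drop_nested _ _ _ _ z y) => //; first by rewrite eq_sym.
    by case/andP: lsorted.
  exact/IH/(smaller _ z).
apply: (@merge_outer _ _ _ _ x y z q) => //; try exact/andP.
by apply/IH/(smaller _ y) => //; apply: subsetDl.
Qed.

End Reductions.

Theorem theorem13 (R : realType) (n : nat) (I : 'I_n -> interval R)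
    (hI : forall i : 'I_n, open_interval (I i)) :
  exists c : 'I_n -> color, quasi_online_proper 3 I c.
Proof.
have [lo lo_hi] := choice hI; have [hi IE] := choice lo_hi.
have stabE t p : stabbed setT lo hi t p = containing I t p.
  by apply/setP => i; rewrite [LHS]inE [RHS]inE IE in_itv inE.
have [c cP] := prefix_colorableT predT setT lo hi.
exists (fun i => if c i then red else blue) => t p _.
rewrite -stabE => ge3; have cS := cP t p isT ge3.
by split; [have [i iS ci] := cS true|have [i iS ci] := cS false];
  exists i; rewrite ?ci.
Qed.
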